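(* Let $p \ge 1$ be a constant. There is a constant $C_p$ (depending only on $p$) and a two-round algorithm in the coordinator model with $k$ sites which, given $m$ and an accuracy parameter $\epsilon\in(0,1)$, for any noisy dataset $\sigma$ of $m$ items partitioned among the $k$ sites and any ground truth $\tau$ of $\sigma$ with $\eta_p(\sigma,\tau)\le 0.4$, outputs at the coordinator, with probability at least $0.99$, a value $\tilde F$ with $$(1-\epsilon - C_p\,\eta_p(\sigma,\tau))\,F_p(\tau) \le \tilde F \le (1+\epsilon + C_p\,\eta_p(\sigma,\tau))\,F_p(\tau),$$ using $O\!\left(\frac{1}{\epsilon^2} k\, m^{1-1/p}\right)$ words of communication.
   Context: Noisy-data framework. A noisy dataset is a sequence $\sigma=(\sigma_1,\ldots,\sigma_m)$ of items. There is a reflexive, symmetric (not necessarily transitive) similarity relation $\sim$ on items, accessible to the parties only via an oracle answering whether two given items are similar. A ground truth of $\sigma$ is a sequence $\tau=(\tau_1,\ldots,\tau_m)\in U^m$ over a finite universe $U$; it is unknown to the algorithm and no relation between $\sim$ and $\tau$ is assumed. For $i\in[m]$ let $B_i^\sigma=\{j:\sigma_j\sim\sigma_i\}$, $B_i^\tau=\{j:\tau_j=\tau_i\}$. $F_p(\tau)=\sum_{u\in U}f_u^p$ where $f_u=|\{i:\tau_i=u\}|$, and $$\eta_p(\sigma,\tau)=\frac{1}{F_p(\tau)}\sum_{i\in[m]}\left(|B_i^\sigma\cup B_i^\tau|^{p-1}-|B_i^\sigma\cap B_i^\tau|^{p-1}\right).$$ Coordinator model: there are $k$ sites and a coordinator;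 the items of $\sigma$ are partitioned among the sites. Computation proceeds in rounds; in each round the coordinator sends a message to each site and each site replies to the coordinator; at the end the coordinator outputs the answer. Communication is measured in words, each item fitting in one word. *)

(* Defs.v *)
From HB Require Import structures.
From mathcomp Require Import all_boot all_order all_algebra.
From mathcomp Require Import reals exp.

Set Implicit Arguments.
Unset Strict Implicit.
Unset Printing Implicit Defensive.

Import Order.TTheory GRing.Theory Num.Theory.
Local Open Scope ring_scope.

Section NoisyData.
Variables (R : realType) (m : nat) (T : Type) (U : finType).
Implicit Types (sim : rel T) (sigma : 'I_m -> T) (tau : 'I_m -> U).

Definition Bsigma sim sigma (i : 'I_m) : {set 'I_m} :=
  [set j | sim (sigma j) (sigma i)].

Definition Btau tau (i : 'I_m) : {set 'I_m} := [set j | tau j == tau i].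

Definition freq tau (u : U) : nat := #|[set i | tau i == u]|.

Definition Fp (p : R) tau : R := \sum_(u : U) (freq tau u)%:R `^ p.

Definition eta_noise (p : R) sim sigma tau : R :=
  (Fp p tau)^-1 *
  \sum_(i < m)
    (#|Bsigma sim sigma i :|: Btau tau i|%:R `^ (p - 1)
     - #|Bsigma sim sigma i :&: Btau tau i|%:R `^ (p - 1)).

End NoisyData.

(* A word is either one item or one integer in {0, ..., m}; integers have to be
   bounded, or a single word could carry an unbounded amount of information.
   A message over T lists its item words and its integer words. *)
Record message (m : nat) (T : Type) := Message {
  msg_items : seq T;
  msg_ints : seq 'I_m.+1
}.

Definition words (m : nat) (T : Type) (x : message m T) : nat :=
  (size (msg_items x) + size (msg_ints x))%N.

(* Items are opaque to the parties. A party that has received the messages v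
   holds the items [memory v] and designates them by handles, i.e., by their
   positions in that sequence. Its decisions may depend only on
   - [view_shape v]: for each message, the number of items and the integers in it;
   - [oracle sim (memory v)]: the similarity of any two items that it holds.
   Handles out of range denote no item: queries on them answer false, and they
   are dropped from outgoing messages. *)
Definition memory (m : nat) (T : Type) (v : seq (message m T)) : seq T :=
  flatten [seq msg_items x | x <- v].

Definition view_shape (m : nat) (T : Type) (v : seq (message m T)) :
    seq (nat * seq 'I_m.+1) :=
  [seq (size (msg_items x), msg_ints x) | x <- v].

Definition oracle (T : Type) (sim : rel T) (s : seq T) : rel nat :=
  fun a b =>
    match onth s a, onth s b with
    | Some x, Some y => sim x y
    | _, _ => false
    end.

Definition strategy (m : nat) (A : Type) : Type :=
  seq (nat * seq 'I_m.+1) -> rel nat -> A.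

Definition decide (m : nat) (T A : Type) (sim : rel T) (f : strategy m A)
    (v : seq (message m T)) : A :=
  f (view_shape v) (oracle sim (memory v)).

Definition send (m : nat) (T : Type) (sim : rel T)
    (f : strategy m (message m nat)) (v : seq (message m T)) : message m T :=
  let out := decide sim f v in
  Message (pmap (onth (memory v)) (msg_items out)) (msg_ints out).

(* Private coins: the coordinator and each site own a seed; all the seeds are
   independent and uniform in the finite type [seed]. *)
Record protocol (R : Type) (k m : nat) := Protocol {
  seed : finType;
  coord_send : seed -> 'I_k -> strategy m (message m nat);
  site_send : 'I_k -> seed -> strategy m (message m nat);
  coord_output : seed -> strategy m R
}.

Definition coins (R : Type) (k m : nat) (P : protocol R k m) : finType :=
  (seed P * {ffun 'I_k -> seed P})%type.

(* Views are the sequences of messages received so far; the initial view of a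
   site holds one message carrying its share of the input. *)
Record state (k m : nat) (T : Type) := State {
  coord_view : seq (message m T);
  site_view : 'I_k -> seq (message m T);
  cost : nat
}.

Section Execution.
Variables (R : Type) (k m : nat) (T : Type).
Variables (P : protocol R k m) (sim : rel T).
Variables (sigma : 'I_m -> T) (part : 'I_m -> 'I_k) (w : coins P).

Definition init_state : state k m T :=
  State [::]
    (fun j => [:: Message [seq sigma i | i <- enum 'I_m & part i == j] [::]])
    0.

Definition round (st : state k m T) : state k m T :=
  let down j := send sim (@coord_send _ _ _ P w.1 j) (coord_view st) in
  let views j := rcons (site_view st j) (down j) in
  let up j := send sim (@site_send _ _ _ P j (w.2 j)) (views j) in
  State (coord_view st ++ [seq up j | j <- enum 'I_k])
    views
    (cost st + \sum_(j < k) (words (down j) + words (up j)))%N.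

Definition exec (rounds : nat) : state k m T := iter rounds round init_state.

Definition communication (rounds : nat) : nat := cost (exec rounds).

Definition output (rounds : nat) : R :=
  decide sim (@coord_output _ _ _ P w.1) (coord_view (exec rounds)).

End Execution.

Definition unif_prob (R : realType) (Omega : finType) (E : pred Omega) : R :=
  #|E|%:R / #|Omega|%:R.

(* Main.v *)
Require Import Defs.
From HB Require Import structures.
From mathcomp Require Import all_boot all_order all_algebra.
From mathcomp Require Import reals exp.
From mathcomp Require Import ring lra zify.

Import Order.TTheory GRing.Theory Num.Theory.
Local Open Scope ring_scope.

Set Implicit Arguments.
Unset Strict Implicit.
Unset Printing Implicit Defensive.

(** Let [a i = |Bsigma i|^(p-1)] and [b i = |Btau i|^(p-1)]. Then [b] sums to
    [Fp], and [a] differs from [b] by at most [eta * Fp] in l1-norm, so it is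
    enough to estimate the sum of [a] from [L = O(m^(1-1/p) / eps^2)] uniform
    samples. Two rounds provide them: each site sends its size and [L] samples
    of its own share, the coordinator combines these into [L] samples of the
    whole dataset and broadcasts them, and the sites return the local similarity
    counts. The noise may destroy the second moment of [a], but not that of
    [min a b], which is at most the second moment of [b], itself at most
    [m^(-1/p) * Fp^2]; Chebyshev's inequality deals with [min a b] and Markov's
    with the nonnegative remainder, whose sum is at most [eta * Fp]. *)

(** * Uniform averages over finite types *)

Definition mean (R : realType) (A : finType) (f : A -> R) : R :=
  (\sum_a f a) / #|A|%:R.

Section Mean.
Variable R : realType.
Implicit Types A B : finType.

Lemma eq_mean A (f g : A -> R) : f =1 g -> mean f = mean g.
Proof. by move=> fg; rewrite /mean (eq_bigr _ (fun a _ => fg a)). Qed.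

Lemma mean_cst A (c : R) : (0 < #|A|)%N -> mean (fun _ : A => c) = c.
Proof.
move=> A0; rewrite /mean sumr_const -[c *+ _]mulr_natr mulfK //.
by rewrite pnatr_eq0 -lt0n.
Qed.

Lemma mean_scale A (c : R) (f : A -> R) : mean (fun a => c * f a) = c * mean f.
Proof. by rewrite /mean -mulr_sumr mulrA. Qed.

Lemma mean_sum A (I : finType) (f : I -> A -> R) :
  mean (fun a => \sum_i f i a) = \sum_i mean (f i).
Proof. by rewrite /mean exchange_big mulr_suml. Qed.

Lemma unif_prob_bij A B (phi : A -> B) (E : pred B) : bijective phi ->
  unif_prob R (fun a => E (phi a)) = unif_prob R E.
Proof.
move=> phi_bij; rewrite /unif_prob (bij_eq_card phi_bij) -!sum1_card.
by rewrite [in RHS](reindex phi) //; exact: onW_bij.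
Qed.

Lemma mean_pair A B (f : A * B -> R) :
  mean f = mean (fun a => mean (fun b => f (a, b))).
Proof.
rewrite /mean card_prod natrM invfM mulrA -mulr_suml [RHS]mulrAC.
congr (_ / _ / _).
by rewrite pair_bigA; apply: eq_bigr => -[].
Qed.

Section FunctionSpace.
Variables (I A : finType) (A_gt0 : (0 < #|A|)%N).

(** Distributivity turns the sum over all functions of a product into a product of sums: the
    coordinates of a uniform function are independent. *)
Lemma mean_ffun_prod (F : I -> A -> R) :
  mean (fun w : {ffun I -> A} => \prod_i F i (w i)) = \prod_i mean (F i).
Proof.
rewrite /mean big_split /= bigA_distr_bigA card_ffun natrX.
by rewrite prodr_const exprVn.
Qed.

Lemma mean_ffun1 (i : I) (g : A -> R) :
  mean (fun w : {ffun I -> A} => g (w i)) = mean g.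
Proof.
have := mean_ffun_prod (fun l => if l == i then g else fun=> 1).
rewrite (bigD1 i) //= eqxx big1 => [|l /negPf->]; last exact: mean_cst.
rewrite mulr1 => <-.
apply: eq_mean => w; rewrite (bigD1 i) //= eqxx big1 ?mulr1 // => l.
by move=> /negPf->.
Qed.

Lemma mean_ffun2 (i j : I) (g h : A -> R) : i != j ->
  mean (fun w : {ffun I -> A} => g (w i) * h (w j)) = mean g * mean h.
Proof.
move=> ij.
have := mean_ffun_prod
  (fun l => if l == i then g else if l == j then h else fun=> 1).
have ji : (j == i) = false by apply/negbTE; rewrite eq_sym.
rewrite (bigD1 i) //= eqxx (bigD1 j) /=; last by rewrite eq_sym.
rewrite ji eqxx big1 => [|l /andP[/negPf-> /negPf->]]; last exact: mean_cst.
rewrite mulr1 => <-; apply: eq_mean => w.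
rewrite (bigD1 i) //= eqxx (bigD1 j) /=; last by rewrite eq_sym.
rewrite ji eqxx big1 => [|l /andP[/negPf-> /negPf->]] //.
by rewrite mulr1.
Qed.

(* For a centred [g] the cross terms of the square vanish by independence. *)
Lemma mean_sqr_sum_ffun (g : A -> R) : mean g = 0 ->
  mean (fun w : {ffun I -> A} => (\sum_i g (w i)) ^+ 2)
    = #|I|%:R * mean (fun a => g a ^+ 2).
Proof.
move=> g0.
under eq_mean => w do
  (rewrite expr2 big_distrl; under eq_bigr => i _ do rewrite big_distrr).
rewrite mean_sum /=; under eq_bigr => i _.
  rewrite mean_sum /= (bigD1 i) //= big1 => [|j ji]; last first.
    by rewrite mean_ffun2 1?eq_sym // g0 mul0r.
  rewrite addr0 (mean_ffun1 i (fun a => g a * g a)).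
  over.
by rewrite sumr_const mulr_natl; congr (_ *+ _); apply: eq_mean => a.
Qed.

End FunctionSpace.

(** Since [size s] divides [n], the range of [z] splits into full blocks, each of which runs through
    [s] exactly once. *)
Lemma mean_nth_modn (I : Type) (x0 : I) (s : seq I) (n : nat) (f : I -> R) :
    (0 < size s)%N -> (0 < n)%N -> (size s %| n)%N ->
  mean (fun z : 'I_n => f (nth x0 s (z %% size s)))
    = (\sum_(i <- s) f i) / (size s)%:R.
Proof.
move=> s0 n0 /dvdnP[q nE].
have q0 : (0 < q)%N by move: n0; rewrite nE; case: (q).
have -> : mean (fun z : 'I_n => f (nth x0 s (z %% size s)))
    = (\sum_(0 <= z < n) f (nth x0 s (z %% size s))) / n%:R.
  by rewrite /mean card_ord big_mkord.
have -> : \sum_(0 <= z < n) f (nth x0 s (z %% size s))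
    = q%:R * \sum_(i <- s) f i.
  rewrite nE {n n0 nE q0}; elim: q => [|q IH].
    by rewrite mul0n big_geq // mul0r.
  rewrite mulSn addnC (@big_cat_nat _ _ _ (q * size s)) ?leq_addr //= IH.
  rewrite -[X in \sum_(X <= _ < _) _]add0n big_addn addKn -natr1 mulrDl mul1r.
  congr (_ + _); rewrite [RHS](big_nth x0) !big_nat.
  by apply: eq_bigr => i /andP[_ il]; rewrite addnC modnMDl modn_small.
by rewrite nE natrM -mulf_div divff ?mul1r // pnatr_eq0 -lt0n.
Qed.

Lemma mean_markov A (f : A -> R) (c : R) : (forall a, 0 <= f a) ->
  unif_prob R (fun a => c < f a) * c <= mean f.
Proof.
move=> f0; rewrite /unif_prob /mean mulrAC ler_wpM2r ?invr_ge0 ?ler0n //.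
rewrite mulr_natl -sumr_const.
apply: (@le_trans _ _ (\sum_(a | c < f a) f a)).
  by apply: ler_sum => a; exact: ltW.
rewrite [leRHS](bigID (fun a => c < f a)) /= lerDl.
by apply: sumr_ge0.
Qed.

(** Union bound: [F] and [G] are the two failure events outside of which [E] is guaranteed. *)
Lemma unif_prob_ge A (E F G : pred A) (x y : R) : (0 < #|A|)%N ->
    (forall a, ~~ F a -> ~~ G a -> E a) ->
    unif_prob R F <= x -> unif_prob R G <= y ->
  1 - (x + y) <= unif_prob R E.
Proof.
move=> A0 FGE Fx Gy.
have : (#|A| <= #|E| + (#|F| + #|G|))%N.
  have cardU (P Q : pred A) : (#|predU P Q| <= #|P| + #|Q|)%N.
    by rewrite -cardUI leq_addr.
  apply: leq_trans (leq_add (leqnn _) (cardU F G)).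
  apply: leq_trans (cardU E (predU F G)).
  apply: subset_leq_card; apply/subsetP => a _; move: (FGE a).
  rewrite /in_mem /=.
  by case: (F a); case: (G a); case: (E a) => //= ->.
rewrite -(ler_nat R) !natrD => h.
have A0' : (0 : R) < #|A|%:R by rewrite ltr0n.
have : 1 <= unif_prob R E + (unif_prob R F + unif_prob R G).
  by rewrite /unif_prob -!mulrDl ler_pdivlMr ?mul1r.
lra.
Qed.

End Mean.

(** * Estimating a sum by uniform sampling *)

Section Sampling.
Variables (R : realType) (A : finType) (m L : nat) (X : A -> 'I_m).
Hypotheses (A_gt0 : (0 < #|A|)%N) (m_gt0 : (0 < m)%N) (L_gt0 : (0 < L)%N).
Hypothesis X_unif :
  forall f : 'I_m -> R, mean (fun a => f (X a)) = (\sum_i f i) / m%:R.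

Definition estimator (f : 'I_m -> R) (w : {ffun 'I_L -> A}) : R :=
  m%:R / L%:R * \sum_t f (X (w t)).

Let m_neq0 : m%:R != 0 :> R. Proof. by rewrite pnatr_eq0 -lt0n. Qed.
Let L_neq0 : L%:R != 0 :> R. Proof. by rewrite pnatr_eq0 -lt0n. Qed.

Lemma estimator_ge0 f w : (forall i, 0 <= f i) -> 0 <= estimator f w.
Proof.
by move=> f0; rewrite mulr_ge0 ?divr_ge0 ?ler0n ?sumr_ge0.
Qed.

Lemma mean_estimator f : mean (estimator f) = \sum_i f i.
Proof.
rewrite /estimator mean_scale mean_sum.
under eq_bigr => t _ do rewrite (mean_ffun1 A_gt0 t (fun a => f (X a))) X_unif.
rewrite sumr_const card_ord -[_ *+ L]mulr_natr.
by field; rewrite ?m_neq0 ?L_neq0.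
Qed.

(** Variances of independent samples add up, and centring a single sample at its mean [mu] only
    decreases its second moment. *)
Lemma estimator_variance f :
  mean (fun w => (estimator f w - \sum_i f i) ^+ 2)
    <= m%:R / L%:R * \sum_i f i ^+ 2.
Proof.
set S := \sum_i f i; set mu := S / m%:R.
pose g (a : A) : R := f (X a) - mu.
have g0 : mean g = 0.
  rewrite (X_unif (fun i => f i - mu)) sumrB sumr_const card_ord.
  by rewrite -[mu *+ m]mulr_natr divfK // subrr mul0r.
have -> : mean (fun w => (estimator f w - S) ^+ 2)
    = (m%:R / L%:R) ^+ 2
      * mean (fun w : {ffun 'I_L -> A} => (\sum_t g (w t)) ^+ 2).
  rewrite -mean_scale; apply: eq_mean => w; rewrite -exprMn; congr (_ ^+ 2).
  rewrite /g sumrB sumr_const card_ord -[mu *+ L]mulr_natr mulrBr.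
  congr (_ - _); rewrite /mu.
  by field; rewrite ?m_neq0 ?L_neq0.
rewrite mean_sqr_sum_ffun // card_ord (X_unif (fun i => (f i - mu) ^+ 2)).
rewrite [leLHS](_ : _ = m%:R / L%:R * \sum_i (f i - mu) ^+ 2); last first.
  by field; rewrite ?m_neq0 ?L_neq0.
rewrite ler_wpM2l ?divr_ge0 ?ler0n //.
under eq_bigr => i _ do rewrite sqrrB.
rewrite big_split sumrB /= sumrMnl -mulr_suml sumr_const card_ord.
rewrite -/S -[mu ^+ 2 *+ m]mulr_natr.
(* In terms of [mu] the squared deviations sum to [\sum_i f i ^+ 2 - mu ^+ 2 * m%:R]. *)
have -> : S = mu * m%:R by rewrite divfK.
have : 0 <= mu ^+ 2 * m%:R by rewrite mulr_ge0 ?sqr_ge0 ?ler0n.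
rewrite -mulr_natr; lra.
Qed.

(* Write [a = c + d] with [c = min a b]: the variance of [c] is controlled by
   that of [b] whatever the noise, hence Chebyshev applies to [c], while [d] is
   nonnegative with sum at most [e], hence Markov applies to [d]. *)
Lemma estimator_noisy (a b : 'I_m -> R) (e V F eps : R) :
    (forall i, 0 <= a i) -> (forall i, 0 <= b i) ->
    F = \sum_i b i -> 0 < F -> 0 < eps ->
    \sum_i `|a i - b i| <= e ->
    m%:R * \sum_i b i ^+ 2 <= V * F ^+ 2 -> 200 * V / eps ^+ 2 <= L%:R ->
  99 / 100 <= unif_prob R (fun w =>
    (1 - eps) * F - 200 * e <= estimator a w <= (1 + eps) * F + 200 * e).
Proof.
move=> a0 b0 FE F0 eps0 abe bV VL.
pose c i := Num.min (a i) (b i); pose d i := a i - c i.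
have c0 i : 0 <= c i by rewrite le_min a0 b0.
have cb i : c i <= b i by rewrite ge_min lexx orbT.
have d0 i : 0 <= d i by rewrite subr_ge0 ge_min lexx.
have dab i : d i <= `|a i - b i|.
  rewrite /d /c; case: (leP (a i) (b i)) => h; first by rewrite subrr normr_ge0.
  exact: ler_norm.
have bcab i : b i - c i <= `|a i - b i|.
  rewrite /c; case: (leP (a i) (b i)) => h; last by rewrite subrr normr_ge0.
  by rewrite distrC ler_norm.
have sd : \sum_i d i <= e by apply: le_trans abe; apply: ler_sum => i _.
have scF : \sum_i c i <= F by rewrite FE; apply: ler_sum => i _.
have Fsc : F - e <= \sum_i c i.
  rewrite FE lerBlDr -lerBlDl -sumrB.
  by apply: le_trans abe; apply: ler_sum => i _.
have sc2 : \sum_i c i ^+ 2 <= \sum_i b i ^+ 2.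
  by apply: ler_sum => i _; rewrite lerXn2r ?nnegrE.
have e0 : 0 <= e by apply: le_trans sd; exact: sumr_ge0.
have estE w : estimator a w = estimator c w + estimator d w.
  rewrite /estimator -mulrDr -big_split; congr (_ * _).
  by apply: eq_bigr => t _; rewrite /d /= addrC subrK.
have eF0 : 0 < (eps * F) ^+ 2 by rewrite exprn_gt0 ?mulr_gt0.
have L0 : (0 : R) < L%:R by rewrite ltr0n.
(* The allowed failure probability is split evenly between Chebyshev for [c] and Markov for [d]. *)
rewrite (_ : 99 / 100 = 1 - (1 / 200 + 1 / 200)); last lra.
apply: (@unif_prob_ge _ _ _
  (fun w => (eps * F) ^+ 2 < (estimator c w - \sum_i c i) ^+ 2)
  (fun w => 200 * e < estimator d w)).
- by rewrite card_ffun expn_gt0 A_gt0.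
- move=> w; rewrite -!leNgt => hc hd; rewrite estE.
  have ed := estimator_ge0 w d0.
  have : `|estimator c w - \sum_i c i| <= eps * F.
    rewrite -[leRHS]gtr0_norm ?mulr_gt0 // -ler_sqr ?nnegrE ?normr_ge0 //.
    by rewrite !real_normK ?num_real.
  rewrite ler_norml => /andP[h1 h2].
  by apply/andP; split; lra.
- rewrite -(ler_pM2r eF0).
  apply: le_trans (mean_markov _ (fun w => sqr_ge0 _)) _.
  apply: le_trans (estimator_variance c) _.
  apply: (@le_trans _ _ (V * F ^+ 2 / L%:R)).
    rewrite mulrAC ler_pM2r ?invr_gt0 //; apply: le_trans bV.
    by rewrite ler_wpM2l ?ler0n.
  move: VL; rewrite ler_pdivrMr ?exprn_gt0 // => VL.
  rewrite ler_pdivrMr // exprMn.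
  have F20 : 0 <= F ^+ 2 by exact: sqr_ge0.
  have := ler_wpM2r F20 VL; lra.
(* Markov's bound cannot be divided by a zero threshold; but if [e = 0], then [d] vanishes
   identically and the event is empty. *)
- have [e_eq0|e_neq0] := eqVneq e 0.
    have sd0 : \sum_i d i = 0.
      by move: sd; rewrite e_eq0 => sd; apply: le_anti; rewrite sd sumr_ge0.
    rewrite /unif_prob eq_card0 ?mul0r ?divr_ge0 ?ler0n // => w; apply/negbTE.
    rewrite /in_mem /= -leNgt /estimator big1 ?mulr0 // => [|t _].
      by rewrite e_eq0 mulr0.
    by move/psumr_eq0P: sd0 => ->.
  have e_gt0 : 0 < 200 * e by rewrite mulr_gt0 ?ltr0n // lt_def e_neq0.
  rewrite -(ler_pM2r e_gt0).
  apply: le_trans (mean_markov _ (fun w => estimator_ge0 w d0)) _.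
  rewrite mean_estimator; lra.
Qed.

End Sampling.

(** * Frequency moments and noise *)

Section Moments.
Variables (R : realType) (m : nat) (U : finType) (tau : 'I_m -> U) (p : R).
Hypotheses (p_ge1 : 1 <= p) (m_gt0 : (0 < m)%N).

Let p_gt0 : 0 < p. Proof. exact: lt_le_trans p_ge1. Qed.
Let p1_ge0 : 0 <= p - 1. Proof. by rewrite subr_ge0. Qed.

Let b (i : 'I_m) : R := #|Btau tau i|%:R `^ (p - 1).

Lemma mul_powRB1 (x : R) : 0 <= x -> x * x `^ (p - 1) = x `^ p.
Proof.
rewrite le_eqVlt => /predU1P[<-|x0].
  by rewrite mul0r powR0 // gt_eqF.
rewrite -{1}(powRr1 (ltW x0)) -powRD ?(gt_eqF x0) ?implybT //.
by rewrite addrC subrK.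
Qed.

Lemma sum_Btau_powR : \sum_i b i = Fp p tau.
Proof.
rewrite (partition_big tau xpredT) //=; apply: eq_bigr => u _.
rewrite (eq_bigr (fun=> (freq tau u)%:R `^ (p - 1))); last first.
  by move=> i /eqP <-.
rewrite sumr_const -[_ `^ _ *+ _]mulr_natl -mul_powRB1 ?ler0n //; congr (_%:R * _).
by apply: eq_card => i; rewrite !inE.
Qed.

Lemma Btau_powR_ge1 i : 1 <= b i.
Proof.
rewrite -(powRr0 (#|Btau tau i|%:R : R)) ler_powR // ler1n.
by apply/card_gt0P; exists i; rewrite inE.
Qed.

Lemma Fp_ge_m : m%:R <= Fp p tau.
Proof.
rewrite -sum_Btau_powR -{1}(card_ord m) -sumr_const.
by apply: ler_sum => i _; exact: Btau_powR_ge1.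
Qed.

Lemma Fp_gt0 : 0 < Fp p tau.
Proof. by apply: lt_le_trans Fp_ge_m; rewrite ltr0n. Qed.

Lemma Btau_powR_le i : b i <= Fp p tau `^ (1 - 1 / p).
Proof.
have cardF : #|Btau tau i|%:R `^ p <= Fp p tau.
  rewrite /Fp (bigD1 (tau i)) //= lerDl sumr_ge0 // => u _.
  exact: powR_ge0.
rewrite /b (_ : p - 1 = p * (1 - 1 / p)); last by field; rewrite gt_eqF.
rewrite powRrM ge0_ler_powR ?nnegrE ?powR_ge0 ?(ltW Fp_gt0) //.
by rewrite subr_ge0 ler_pdivrMr // mul1r.
Qed.

(** The sum of squares is at most the maximum of [b] times its sum. Writing [m] as [m]^ (1 - 1 / p)
    * m [^ (1 / p)] and bounding the last factor through [m <= Fp] completes the exponent of [Fp] to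
    2. *)
Lemma sum_Btau_powR_sqr :
  m%:R * \sum_i b i ^+ 2 <= m%:R `^ (1 - 1 / p) * Fp p tau ^+ 2.
Proof.
have F0 := Fp_gt0.
have m0 : (0 : R) < m%:R by rewrite ltr0n.
have b2 : \sum_i b i ^+ 2 <= Fp p tau `^ (1 - 1 / p) * Fp p tau.
  rewrite -[X in _ <= _ * X]sum_Btau_powR mulr_sumr; apply: ler_sum => i _.
  by rewrite expr2 ler_wpM2r ?Btau_powR_le ?powR_ge0.
have split_powR (x : R) : 0 < x -> x `^ (1 - 1 / p) * x `^ (1 / p) = x.
  move=> x0; rewrite -powRD ?(gt_eqF x0) ?implybT //.
  by rewrite subrK powRr1 // ltW.
have mF : m%:R `^ (1 / p) <= Fp p tau `^ (1 / p) :> R.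
  by rewrite ge0_ler_powR ?nnegrE ?(ltW F0) ?Fp_ge_m ?divr_ge0 ?(ltW p_gt0).
rewrite -[X in X * _ <= _](split_powR _ m0) -mulrA ler_wpM2l ?powR_ge0 //.
apply: le_trans (ler_pM (powR_ge0 _ _) _ mF b2) _.
  by rewrite sumr_ge0 // => i _; exact: sqr_ge0.
by rewrite mulrA [X in X * _]mulrC split_powR // expr2.
Qed.

Lemma noise_le (T : Type) (sim : rel T) (sigma : 'I_m -> T) :
  \sum_i `|#|Bsigma sim sigma i|%:R `^ (p - 1) - b i|
    <= eta_noise p sim sigma tau * Fp p tau.
Proof.
rewrite /eta_noise mulrAC mulVf ?gt_eqF ?Fp_gt0 // mul1r.
have mono (A B : {set 'I_m}) : A \subset B ->
    #|A|%:R `^ (p - 1) <= #|B|%:R `^ (p - 1) :> R.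
  move=> AB; rewrite ge0_ler_powR ?nnegrE ?ler0n // ler_nat.
  exact: subset_leq_card.
apply: ler_sum => i _; set B := Bsigma _ _ _; rewrite /b; set C := Btau _ _.
have := (mono _ _ (subsetIl B C), mono _ _ (subsetIr B C)).
have := (mono _ _ (subsetUl B C), mono _ _ (subsetUr B C)).
move=> [h1 h2] [h3 h4]; rewrite ler_norml; lra.
Qed.

End Moments.

(** * The protocol *)

Section SamplingProtocol.
Variables (R : realType) (p : R) (k m L : nat).

(* The site seeds must be uniform modulo the size of the share, which is not
   known in advance; every possible size divides m!. *)
Definition sample_seed : finType := {ffun 'I_L -> 'I_(m`!)}.

(* A view of two messages (the share and the first message of the coordinator)
   identifies the first round. *)
Definition site_strategy (s : sample_seed) : strategy m (message m nat) :=
  fun vs q =>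
    let n := (head (0%N, [::]) vs).1 in
    if size vs == 2%N then
      Message [seq (s t %% n)%N | t <- enum 'I_L] [:: inord n]
    else
      Message [::]
        [seq inord (count (fun a => q a (n + t)%N) (iota 0 n))
           | t : 'I_L <- enum 'I_L].

Definition owner_list (n : 'I_k -> nat) : seq 'I_k :=
  flatten [seq nseq (n j) j | j <- enum 'I_k].

(* A uniform entry of [owners] is a site drawn with probability proportional to
   the size of its share; its t-th sample is then uniform over the dataset. *)
Definition coord_strategy (s : sample_seed) (j0 : 'I_k) :
    strategy m (message m nat) :=
  fun vs _ =>
    if vs is [::] then Message [::] [::] else
    let owners :=
      owner_list (fun j => nth ord0 (nth (0%N, [::]) vs j).2 0) in
    Message
      [seq flatten_index [seq x.1 | x <- vs] (nth j0 owners (s t %% m)) t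
         | t <- enum 'I_L]
      [::].

(** The final view lists the [k] replies of the first round before those of the second, hence the
    index [k + j]. *)
Definition coord_estimate (s : sample_seed) : strategy m R :=
  fun vs _ =>
    m%:R / L%:R *
    \sum_(t < L)
      (\sum_(j < k) (nth ord0 (nth (0%N, [::]) vs (k + j)).2 t : nat))%:R
        `^ (p - 1).

Definition sampling_protocol : protocol R k m :=
  @Protocol R k m sample_seed coord_strategy (fun=> site_strategy)
    coord_estimate.

End SamplingProtocol.

(** This resolves the handles of the coordinator: row [r] is a message in its view, column [c] an
    item of that message. *)
Lemma onth_flatten (T : Type) (ss : seq (seq T)) (r c : nat) :
  (c < size (nth [::] ss r))%N ->
  onth (flatten ss) (flatten_index (shape ss) r c) = onth (nth [::] ss r) c.
Proof.
rewrite /flatten_index; elim: ss r => [|s ss IH] [|r] //= h.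
  by rewrite onth_cat h.
by rewrite onth_cat -addnA ltnNge leq_addr /= addKn IH.
Qed.

Lemma onth_nth_some (T : Type) (x0 : T) (s : seq T) (n : nat) :
  (n < size s)%N -> onth s n = Some (nth x0 s n).
Proof. by elim: s n => [|x s IH] [|n] //= /IH. Qed.

Lemma pmap_map_some (A B C : Type) (f : A -> B) (g : B -> option C)
    (h : A -> C) (s : seq A) :
  (forall a, g (f a) = Some (h a)) -> pmap g (map f s) = map h s.
Proof. by move=> gf; elim: s => //= a s ->; rewrite gf. Qed.

(** * Execution of the protocol on a fixed input *)

Section Run.
Variables (R : realType) (p : R) (k m L : nat) (T : Type) (sim : rel T).
Variables (sigma : 'I_m -> T) (part : 'I_m -> 'I_k) (i0 : 'I_m).

Let j0 := part i0.

Definition share (j : 'I_k) : seq 'I_m := [seq i <- enum 'I_m | part i == j].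

Lemma size_share_le j : (size (share j) <= m)%N.
Proof. by rewrite -[leqRHS](size_enum_ord m) size_filter count_size. Qed.

Lemma sum_share (V : nmodType) (f : 'I_m -> V) :
  \sum_j \sum_(i <- share j) f i = \sum_i f i.
Proof.
rewrite [RHS](partition_big part xpredT) //=; apply: eq_bigr => j _.
by rewrite big_filter enumT.
Qed.

Definition owners : seq 'I_k := owner_list (fun j => size (share j)).

Lemma big_owners (V : nmodType) (f : 'I_k -> V) :
  \sum_(j <- owners) f j = \sum_j f j *+ size (share j).
Proof.
rewrite /owners /owner_list big_flatten big_map big_enum /=.
by apply: eq_bigr => j _; rewrite big_nseq iter_addr_0.
Qed.

Lemma size_owners : size owners = m.
Proof.
rewrite size_flatten /shape -map_comp sumnE big_map big_enum /=.
rewrite -[RHS]card_ord -sum1_card (partition_big part xpredT) //=.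
apply: eq_bigr => j _.
by rewrite size_nseq size_filter -sum1_count enumT.
Qed.

(** One sample as a function of the coins it consumes: [a.1] belongs to the coordinator and selects
    a site, [a.2 j] belongs to site [j] and selects an index of its share. *)
Definition sampled (a : 'I_(m`!) * {ffun 'I_k -> 'I_(m`!)}) : 'I_m :=
  let j := nth j0 owners (a.1 %% m) in
  nth i0 (share j) (a.2 j %% size (share j)).

(** The coins are grouped by party; grouping them by sample number instead exhibits the samples as
    functions of independent coordinates. *)
Definition coins_at (w : coins (sampling_protocol p k m L)) :
    {ffun 'I_L -> 'I_(m`!) * {ffun 'I_k -> 'I_(m`!)}} :=
  [ffun t => (w.1 t, [ffun j => w.2 j t])].

Lemma coins_at_bij : bijective coins_at.
Proof.
exists (fun u : {ffun 'I_L -> 'I_(m`!) * {ffun 'I_k -> 'I_(m`!)}} =>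
  ([ffun t => (u t).1], [ffun j => [ffun t => (u t).2 j]])).
  move=> [s f]; congr pair; first by apply/ffunP => t; rewrite !ffunE.
  by apply/ffunP => j; apply/ffunP => t; do 3!rewrite ffunE /=; rewrite ffunE.
move=> u; apply/ffunP => t; rewrite !ffunE /= [RHS]surjective_pairing.
by congr pair; apply/ffunP => j; rewrite ffunE /= !ffunE.
Qed.

(** A site is drawn with probability [size (share j) / m], then an index within it with probability
    [1 / size (share j)]; the sizes cancel, and empty shares are never drawn. *)
Lemma sampled_unif (f : 'I_m -> R) :
  mean (fun a => f (sampled a)) = (\sum_i f i) / m%:R.
Proof.
have m_gt0 : (0 < m)%N := leq_ltn_trans (leq0n _) (ltn_ord i0).
have M_gt0 := fact_gt0 m.
pose G j := (\sum_(i <- share j) f i) / (size (share j))%:R.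
have dvdM n : (0 < n <= m)%N -> (n %| m`!)%N by move=> h; exact: dvdn_fact.
rewrite mean_pair.
rewrite (@eq_mean _ _ _ (fun x : 'I_(m`!) => G (nth j0 owners (x %% size owners)))).
  rewrite mean_nth_modn // ?size_owners ?dvdM ?m_gt0 ?leqnn //.
  congr (_ / _); rewrite big_owners -[RHS]sum_share; apply: eq_bigr => j _.
  rewrite /G -[_ / _ *+ _]mulr_natr; have [s0|s0] := posnP (size (share j)).
    by rewrite s0 mulr0 (size0nil s0) big_nil.
  by rewrite divfK // pnatr_eq0 -lt0n.
move=> x; rewrite size_owners /sampled /=; set j := nth _ _ _.
have s0 : (0 < size (share j))%N.
  have : j \in owners by rewrite mem_nth // size_owners ltn_mod.
  by case/flatten_mapP => j' _; rewrite mem_nseq => /andP[+ /eqP ->].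
rewrite (mean_ffun1 _ j (fun z : 'I_(m`!) =>
  f (nth i0 (share j) (z %% size (share j))))) ?card_ord //.
by rewrite mean_nth_modn // dvdM // s0 size_share_le.
Qed.

Definition first_reply (s : 'I_L -> 'I_(m`!)) (j : 'I_k) : message m T :=
  let n := size (share j) in
  Message
    (if (0 < n)%N then [seq sigma (nth i0 (share j) (s t %% n)) | t <- enum 'I_L]
     else [::])
    [:: inord n].

Definition second_reply (x : 'I_L -> 'I_m) (j : 'I_k) : message m T :=
  Message [::]
    [seq inord (count (fun i => sim (sigma i) (sigma (x t))) (share j))
       | t <- enum 'I_L].

Lemma site_send_first (s : sample_seed m L) j :
  send sim (site_strategy s)
    [:: Message [seq sigma i | i <- share j] [::]; Message [::] [::]]
  = first_reply s j.
Proof.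
rewrite /send /decide /= /memory /= cats0 size_map /first_reply.
congr Message; case: posnP => [n0|n_gt0].
  (* A site with an empty share has an empty memory, so all its handles are dropped. *)
  by rewrite (size0nil n0) /=; elim: (enum _) => //= t l ->; rewrite onth0n.
apply: pmap_map_some => t; rewrite onth_map (onth_nth_some i0) //.
by rewrite ltn_mod.
Qed.

Lemma site_send_second (s : sample_seed m L) (x : 'I_L -> 'I_m) j :
  send sim (site_strategy s)
    [:: Message [seq sigma i | i <- share j] [::]; Message [::] [::];
        Message [seq sigma (x t) | t <- enum 'I_L] [::]]
  = second_reply x j.
Proof.
rewrite /send /decide /= /memory /= cats0 size_map /second_reply.
congr Message; apply: eq_map => t; congr inord.
rewrite -[in RHS](mkseq_nth i0 (share j)) /mkseq count_map.
apply: eq_in_count => a; rewrite mem_iota /= => a_lt.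
(* The memory is the share followed by the broadcast samples: [a] falls in the former, and the
   handle [n + t] denotes the [t]-th sample. *)
rewrite /oracle !onth_cat size_map a_lt ltnNge leq_addr /= addKn.
rewrite 2!onth_map (onth_nth_some i0) // (onth_nth_some t) ?size_enum_ord //=.
by rewrite nth_ord_enum.
Qed.

Lemma coord_send_second (w : coins (sampling_protocol p k m L)) (j : 'I_k) :
  send sim (coord_strategy (w.1 : sample_seed m L) j)
    [seq first_reply (w.2 j') j' | j' <- enum 'I_k]
  = Message [seq sigma (sampled (coins_at w t)) | t <- enum 'I_L] [::].
Proof.
have m_gt0 : (0 < m)%N := leq_ltn_trans (leq0n _) (ltn_ord i0).
rewrite /send /decide /coord_strategy.
set v := [seq first_reply _ _ | _ <- _].
have size_v : size v = k by rewrite size_map size_enum_ord.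
have nth_v (j' : 'I_k) x0 : nth x0 v j' = first_reply (w.2 j') j'.
  by rewrite (nth_map j') ?size_enum_ord // nth_ord_enum.
have v_shape : [seq x.1 | x <- view_shape v] = shape [seq msg_items x | x <- v].
  by rewrite /view_shape /shape -!map_comp.
have view_nth (j' : 'I_k) :
    nth (0%N, [::]) (view_shape v) j'
    = (size (msg_items (first_reply (w.2 j') j')), [:: inord (size (share j'))]).
  rewrite (nth_map (Message [::] [::])) ?size_v //.
  by rewrite nth_v.
have ownersE :
    owner_list (fun j => nth ord0 (nth (0%N, [::]) (view_shape v) j).2 0)
    = owners.
  congr flatten; apply: eq_map => l.
  by rewrite view_nth /= inordK // ltnS size_share_le.
(* The strategy recognises the first round by an empty view; this is not the case here, since
   [k > 0] as witnessed by [j]. *)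
case E : (view_shape v) => [|y vs].
  have := congr1 size E; rewrite size_map size_v /= => k0.
  by have := ltn_ord j; rewrite {2}k0.
rewrite -E ownersE v_shape /=; congr Message.
apply: pmap_map_some => t; rewrite /memory.
have tm : (w.1 t %% m < size owners)%N by rewrite size_owners ltn_mod.
(* The strategy uses the recipient [j] as default value; the position being in range, every site is
   sent the same samples. *)
rewrite (set_nth_default j0) // ffunE /sampled /= ffunE.
set j' := nth _ _ _.
have s0 : (0 < size (share j'))%N.
  have : j' \in owners by rewrite mem_nth.
  by case/flatten_mapP => j'' _; rewrite mem_nseq => /andP[+ /eqP ->].
have itemsE : nth [::] [seq msg_items x | x <- v] j'
    = [seq sigma (nth i0 (share j') (w.2 j' t %% size (share j')))
         | t <- enum 'I_L].
  rewrite (nth_map (Message [::] [::])) ?size_v //.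
  by rewrite nth_v /= s0.
rewrite onth_flatten itemsE; last by rewrite size_map size_enum_ord.
by rewrite onth_map (onth_nth_some t) ?size_enum_ord //= nth_ord_enum.
Qed.

Lemma coord_view1 (w : coins (sampling_protocol p k m L)) :
  coord_view (exec sim sigma part w 1)
  = [seq first_reply (w.2 j) j | j <- enum 'I_k].
Proof. by apply: eq_map => j; rewrite -site_send_first. Qed.

Lemma site_view2 (w : coins (sampling_protocol p k m L)) j :
  site_view (exec sim sigma part w 2) j
  = [:: Message [seq sigma i | i <- share j] [::]; Message [::] [::];
        Message [seq sigma (sampled (coins_at w t)) | t <- enum 'I_L] [::]].
Proof. by rewrite -(coord_send_second w j) -coord_view1. Qed.

Lemma coord_view2 (w : coins (sampling_protocol p k m L)) :
  coord_view (exec sim sigma part w 2)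
  = [seq first_reply (w.2 j) j | j <- enum 'I_k]
    ++ [seq second_reply (fun t => sampled (coins_at w t)) j | j <- enum 'I_k].
Proof.
rewrite -coord_view1; congr cat; apply: eq_map => j.
by rewrite -(site_send_second (w.2 j)) -site_view2.
Qed.

(** The first round costs a site at most [L] items and its size, the coordinator's message being
    empty; the second costs [L] items down and [L] counts up. *)
Lemma communication_le (w : coins (sampling_protocol p k m L)) :
  (communication sim sigma part w 2 <= k * (3 * L + 1))%N.
Proof.
have -> : communication sim sigma part w 2
    = (\sum_(j < k) words (first_reply (w.2 j) j)
      + \sum_(j < k) (L + L))%N.
  rewrite /communication /exec /= add0n; congr addn; apply: eq_bigr => j _.
    by rewrite -site_send_first.
  rewrite (_ : words _ = L); last first.
    have := coord_send_second w j; rewrite -coord_view1 => /(congr1 (@words _ _)).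
    by rewrite /words /= size_map size_enum_ord addn0.
  congr addn.
  have := site_send_second (w.2 j) (fun t => sampled (coins_at w t)) j.
  rewrite -site_view2 => /(congr1 (@words _ _)).
  by rewrite {2}/words /= size_map size_enum_ord.
rewrite -big_split /= -[X in (_ <= X * _)%N]card_ord -sum_nat_const.
apply: leq_sum => j _; rewrite /words /first_reply /=.
by case: ifP => _; rewrite /= 1?size_map 1?size_enum_ord; lia.
Qed.

(** The shares partition the dataset, so the local counts for a sample add up to the size of its
    ball. *)
Lemma output_estimator (w : coins (sampling_protocol p k m L)) :
  output sim sigma part w 2
  = estimator sampled (fun i => #|Bsigma sim sigma i|%:R `^ (p - 1)) (coins_at w).
Proof.
rewrite /output coord_view2 /decide /= /coord_estimate /estimator.
congr (_ * _); apply: eq_bigr => t _; congr (_%:R `^ _).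
set x := sampled (coins_at w t).
have -> : #|Bsigma sim sigma x|
    = (\sum_j count (fun i => sim (sigma i) (sigma x)) (share j))%N.
  rewrite -sum1_card (partition_big part xpredT) //=; apply: eq_bigr => j _.
  rewrite count_filter -sum1_count enumT; apply: eq_bigl => i.
  by rewrite !inE.
apply: eq_bigr => j _; rewrite /view_shape map_cat nth_cat 2!size_map.
rewrite size_enum_ord ltnNge leq_addr /= addKn -map_comp.
rewrite (nth_map j) ?size_enum_ord //= nth_ord_enum.
rewrite (nth_map t) ?size_enum_ord //= nth_ord_enum inordK // ltnS.
exact: leq_trans (count_size _ _) (size_share_le _).
Qed.

End Run.

Theorem theorem2 (R : realType) (p : R) (hp : 1 <= p) :
  exists (Cp K : R) (A : forall k m : nat, R -> protocol R k m),
  forall (k m : nat) (eps : R), (0 < m)%N -> 0 < eps < 1 ->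
  forall (T : Type) (sim : rel T), reflexive sim -> symmetric sim ->
  forall (sigma : 'I_m -> T) (part : 'I_m -> 'I_k),
    (forall w : coins (A k m eps),
       (communication sim sigma part w 2)%:R
         <= K * (1 / eps ^+ 2 * k%:R * m%:R `^ (1 - 1 / p)))
    /\
    (forall (U : finType) (tau : 'I_m -> U),
       eta_noise p sim sigma tau <= 4 / 10 ->
       99 / 100 <=
       unif_prob R (fun w : coins (A k m eps) =>
         (1 - eps - Cp * eta_noise p sim sigma tau) * Fp p tau
           <= output sim sigma part w 2
           <= (1 + eps + Cp * eta_noise p sim sigma tau) * Fp p tau)).
Proof.
pose L (m : nat) (eps : R) : nat :=
  (Num.truncn (200 * m%:R `^ (1 - 1 / p) / eps ^+ 2)).+1.
exists 200, 604, (fun k m eps => sampling_protocol p k m (L m eps)).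
move=> k m eps m_gt0 /andP[eps0 eps1] T sim _ _ sigma part.
have p_gt0 : 0 < p by exact: lt_le_trans hp.
have p'_ge0 : 0 <= 1 - 1 / p by rewrite subr_ge0 ler_pdivrMr // mul1r.
have e2_gt0 : 0 < eps ^+ 2 by rewrite exprn_gt0.
pose i0 := Ordinal m_gt0; set N := L m eps.
split=> [w|U tau _].
  pose y := m%:R `^ (1 - 1 / p) / eps ^+ 2.
  have y_ge1 : 1 <= y.
    rewrite ler_pdivlMr // [1 * eps ^+ 2]mul1r; apply: (@le_trans _ _ 1).
      by rewrite exprn_ile1 ?ltW.
    by rewrite -[leLHS](powRr0 (m%:R : R)) ler_powR // ler1n.
  have N_le : N%:R <= 200 * y + 1.
    rewrite /N /L -mulrA -/y -natr1 lerD2r truncn_le //.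
    by rewrite mulr_ge0 ?ler0n // (le_trans _ y_ge1).
  have -> : 1 / eps ^+ 2 * k%:R * m%:R `^ (1 - 1 / p) = k%:R * y.
    by rewrite /y mul1r mulrAC mulrC [_^-1 * _]mulrC.
  apply: (@le_trans _ _ (k * (3 * N + 1))%:R).
    by rewrite ler_nat; exact: (communication_le sim sigma part i0).
  rewrite natrM mulrCA ler_wpM2l ?ler0n // natrD natrM; lra.
have F0 := Fp_gt0 tau hp m_gt0.
set eta := eta_noise _ _ _ _.
pose X := sampled part i0.
pose a i : R := #|Bsigma sim sigma i|%:R `^ (p - 1).
have : 99 / 100 <= unif_prob R (fun u : {ffun 'I_N -> _} =>
    (1 - eps) * Fp p tau - 200 * (eta * Fp p tau) <= estimator X a u
      <= (1 + eps) * Fp p tau + 200 * (eta * Fp p tau)).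
  apply: (@estimator_noisy _ _ _ _ _ _ m_gt0 _ _ a
      (fun i => #|Btau tau i|%:R `^ (p - 1)) _ (m%:R `^ (1 - 1 / p))) => //.
  - by rewrite card_prod card_ffun !card_ord muln_gt0 expn_gt0 fact_gt0.
  - exact: sampled_unif.
  - by move=> i; exact: powR_ge0.
  - by move=> i; exact: powR_ge0.
  - by rewrite sum_Btau_powR.
  - exact: noise_le.
  - exact: sum_Btau_powR_sqr.
  - exact/ltW/truncnS_gt.
(* The bound is carried back from the coins grouped by sample to the coins of the protocol. *)
rewrite -(unif_prob_bij _ _ (coins_at_bij p k m N)) => /le_trans; apply.
rewrite ler_wpM2r ?invr_ge0 ?ler0n // ler_nat; apply: subset_leq_card.
apply/subsetP => w; rewrite !unfold_in -(output_estimator sim sigma part i0 w).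
by rewrite !mulrBl !mulrDl !mulrA.
Qed.
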